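(* Let $G$ be a commutative group, $d\ge 0$, and let $U\subset G$ be a $d$-dimensional quasicube. Then for every $V\subset U$ we have \[ \beta(V)=|V| \quad\text{and}\quad \alpha(V)\ge |V|^{1/2}. \] In particular $\beta(U)=2^d$ and $\alpha(U)\ge 2^{d/2}$.
   Context: All groups are commutative and written additively; sets $A,B$ below range over nonempty finite subsets of $G$. For a finite $U\subset G$: the induced doubling is $\alpha(U)=\inf_{A\supset U,\,B\supset U}\frac{|A+B|}{\sqrt{|A||B|}}$, and the induced tripling is $\beta(U)=\inf_{A,B}\frac{|A+B+U|}{\sqrt{|A||B|}}$ (infimum over all nonempty finite $A,B\subset G$). Quasicubes are defined recursively: a $0$-dimensional quasicube is any singleton; a finite set $U\subset G$ is a $d$-dimensional quasicube ($d\ge1$) if there is a proper subgroup $G'$ of $G$ and two distinct cosets $G'+x$, $G'+y$ such that $U\subset (G'+x)\cup(G'+y)$, both $U\cap(G'+x)$ and $U\cap(G'+y)$ are $(d-1)$-dimensional quasicubes, and $x-y$ has infinite order in the factor group $G/G'$. *)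

(* Defs.v *)
From HB Require Import structures.
From mathcomp Require Import all_boot all_order all_algebra.
From mathcomp Require Import finmap.
From mathcomp Require Import boolp classical_sets reals.
Set Implicit Arguments. Unset Strict Implicit. Unset Printing Implicit Defensive.
Import Order.TTheory GRing.Theory Num.Theory.
Local Open Scope fset_scope.
Local Open Scope ring_scope.

Definition sumset (G : zmodType) (A B : {fset G}) : {fset G} :=
  [fset a + b | a in A, b in B].

Definition ratio (R : realType) (s a b : nat) : R :=
  s%:R / Num.sqrt (a%:R * b%:R).

Definition alpha (R : realType) (G : zmodType) (U : {fset G}) : R :=
  inf [set r : R | exists A B : {fset G},
        [/\ A != fset0, B != fset0, U `<=` A, U `<=` B &
            r = ratio R #|` sumset A B| #|` A| #|` B|]].

Definition beta (R : realType) (G : zmodType) (U : {fset G}) : R :=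
  inf [set r : R | exists A B : {fset G},
        [/\ A != fset0, B != fset0 &
            r = ratio R #|` sumset (sumset A B) U| #|` A| #|` B|]].

Definition is_subgroup (G : zmodType) (H : set G) : Prop :=
  H 0 /\ (forall u v, H u -> H v -> H (u - v)).

Definition coset_part (G : zmodType) (H : set G) (x : G) (U : {fset G}) : {fset G} :=
  [fset u in U | `[< H (u - x) >]].

Inductive quasicube (G : zmodType) : nat -> {fset G} -> Prop :=
| quasicube0 : forall g : G, quasicube 0 [fset g]
| quasicubeS : forall (d : nat) (U : {fset G}) (H : set G) (x y : G),
    is_subgroup H ->
    (exists g, ~ H g) ->
    ~ H (x - y) ->
    (forall u, u \in U -> H (u - x) \/ H (u - y)) ->
    quasicube d (coset_part H x U) ->
    quasicube d (coset_part H y U) ->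
    (forall n : nat, (0 < n)%N -> ~ H ((x - y) *+ n)) -> (* x-y of infinite order in G/H *)
    quasicube d.+1 U.

(* Main.v *)
(* The lower bound for beta is |V|^2 |A| |B| <= |A + B + V|^2 for all A and B.
   By induction on the quasicube it holds for the two coset parts V_x, V_y of V.
   When A and B lie in one coset each of K = H + Z(x - y), cutting A, B and
   A + B + V into cosets of H reduces the claim to an inequality for sequences:
   if M(i+j) >= p f(i) g(j) and M(i+j+1) >= q f(i) g(j) with p = |V_y| and
   q = |V_x|, then sum M >= (p + q) ||f||_2 ||g||_2.  This is a Prekopa-Leindler
   inequality for the step functions obtained by spreading each f(i), g(j) over
   a unit interval with exponential weight (q / p)^t.  General A and B follow by
   comparing with the largest K-coset parts of A and of B.

   For alpha, take X in A minimizing |X + B| / |X| = k.  Petridis' lemma gives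
   |X + B + V| <= k |X + V| <= k^2 |X|, while |X + B + V| >= |V| sqrt(|X| |B|);
   with |B| <= |A| this yields |V| |A| |B| <= |A + B|^2. *)

Require Import Defs.
From HB Require Import structures.
From mathcomp Require Import all_boot all_order all_algebra.
From mathcomp Require Import finmap ssrAC.
From mathcomp Require Import boolp classical_sets reals.
From mathcomp Require Import ring lra zify.
Import Order.TTheory GRing.Theory Num.Theory.
Local Open Scope fset_scope.
Local Open Scope ring_scope.

(** * A two-point Prekopa-Leindler inequality *)

(* The integral over (0, c] of the step function that equals M k / l ^ k on
   (l ^ k.+1, l ^ k], for k < N and c <= 1. *)
Fixpoint tail_integral {R : rcfType} (l : R) (N : nat) (M : nat -> R) (c : R)
    : R :=
  if N is N'.+1 then
    M 0%N * Num.max 0 (c - l) +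
    tail_integral l N' (fun k => M k.+1) (Num.min 1 (c / l))
  else 0.

(* For l <= a <= 1, the integral of F(t)^2 d(t^2) over (0, a], where F is the
   step function that equals f i / l ^ i on (l ^ i.+1, l ^ i], for i < n. *)
Definition tail_mass {R : rcfType} (l : R) (n : nat) (f : nat -> R) (a : R)
    : R :=
  if n is n'.+1 then
    f 0%N ^+ 2 * (a ^+ 2 - l ^+ 2) + (1 - l ^+ 2) * \sum_(i < n') f i.+1 ^+ 2
  else 0.

Lemma tail_integral_ge0 (R : rcfType) (l : R) N M c :
  (forall k, 0 <= M k) -> 0 <= tail_integral l N M c.
Proof.
elim: N M c => [|N IH] M c M0 //=.
by rewrite addr_ge0 ?mulr_ge0 ?IH // le_max lexx.
Qed.

Lemma tail_integral_homo (R : rcfType) (l : R) N M c c' : 0 < l ->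
  (forall k, 0 <= M k) -> c <= c' ->
  tail_integral l N M c <= tail_integral l N M c'.
Proof.
move=> l_gt0; elim: N M c c' => [|N IH] M c c' M0 le_cc' //=.
rewrite lerD ?ler_wpM2l ?IH //.
  by rewrite ge_max !le_max lexx lerB // orbT.
by rewrite le_min !ge_min lexx /= ler_wpM2r ?orbT // invr_ge0 ltW.
Qed.

(** Below [l] the first cell is not reached, and rescaling by [1 / l] turns the other cells into
    those of the shifted sequence. *)
Lemma tail_integralS (R : rcfType) (l : R) N M c : 0 < l -> c <= l ->
  tail_integral l N.+1 M c = tail_integral l N (fun k => M k.+1) (c / l).
Proof.
move=> l_gt0 le_cl /=; rewrite max_l ?subr_le0 // mulr0 add0r min_r //.
by rewrite ler_pdivrMr // mul1r.
Qed.

Lemma tail_integral1 (R : rcfType) (l : R) N M : 0 < l -> l < 1 ->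
  tail_integral l N M 1 = (1 - l) * \sum_(k < N) M k.
Proof.
move=> l_gt0 l_lt1.
elim: N M => [|N IH] M /=; first by rewrite big_ord0 mulr0.
rewrite max_r ?subr_ge0 ?(ltW l_lt1) // min_l; last first.
  by rewrite ler_pdivlMr // mul1r ltW.
by rewrite IH big_ord_recl /= [RHS]mulrDr [M 0%N * _]mulrC.
Qed.

Lemma tail_mass1 (R : rcfType) (l : R) n f :
  tail_mass l n f 1 = (1 - l ^+ 2) * \sum_(i < n) f i ^+ 2.
Proof.
case: n => [|n] /=; first by rewrite big_ord0 mulr0.
by rewrite big_ord_recl /= expr1n [RHS]mulrDr mulrC.
Qed.

(** On [(l ^ 2, 1]] the integrand takes only the values [M 0] and [M 1 / l], both at least [m]; an
    interval straddling [l] is split there. *)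
Lemma tail_integral_increment (R : rcfType) (l : R) N M c c' m :
  0 < l -> l < 1 -> (forall k, 0 <= M k) ->
  m <= M 0%N -> l * m <= M 1%N -> l ^+ 2 <= c -> c <= c' -> c' <= 1 ->
  (c' - c) * m <= tail_integral l N.+2 M c' - tail_integral l N.+2 M c.
Proof.
move=> l_gt0 l_lt1 M0 mM0 mM1 lc cc' c'1.
have step_low d d' : l ^+ 2 <= d -> d <= d' -> d' <= l ->
    (d' - d) * m <= tail_integral l N.+2 M d' - tail_integral l N.+2 M d.
  move=> ld dd' d'l; rewrite (tail_integralS _ _ _ _ d') // (tail_integralS _ _ _ _ d) ?(le_trans dd') //=.
  have ldl e : l ^+ 2 <= e -> l <= e / l by move=> le; rewrite ler_pdivlMr.
  have l_le_d := ldl _ ld; have l_le_d' := ldl _ (le_trans ld dd').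
  rewrite !max_r ?subr_ge0 // !min_l ?[1 <= _]ler_pdivlMr ?mul1r //.
  set t := tail_integral _ _ _ _.
  have -> : M 1%N * (d' / l - l) + t - (M 1%N * (d / l - l) + t) =
            (d' - d) * m + (M 1%N - l * m) * ((d' - d) / l).
    by field; rewrite gt_eqF.
  by rewrite lerDl mulr_ge0 ?subr_ge0 // divr_ge0 ?subr_ge0 // ltW.
have step_high d d' : l <= d -> d <= d' ->
    (d' - d) * m <= tail_integral l N.+2 M d' - tail_integral l N.+2 M d.
  move=> ld dd'.
  have mono : tail_integral l N.+1 (fun k => M k.+1) (Num.min 1 (d / l)) <=
              tail_integral l N.+1 (fun k => M k.+1) (Num.min 1 (d' / l)).
    apply: tail_integral_homo => //.
    by rewrite le_min !ge_min lexx /= ler_wpM2r ?orbT // invr_ge0 ltW.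
  move: mono; rewrite [tail_integral l N.+2 M d']/= [tail_integral l N.+2 M d]/=.
  rewrite -!/(tail_integral l N.+1 (fun k => M k.+1) _).
  set t := tail_integral _ _ _ _; set t' := tail_integral _ _ _ _ => tt'.
  rewrite !max_r ?subr_ge0 ?(le_trans ld) //.
  have : (d' - d) * m <= (d' - d) * M 0%N by rewrite ler_wpM2l ?subr_ge0.
  by lra.
case: (leP c' l) => c'l; first exact: step_low.
case: (leP l c) => lc'; first exact: step_high.
have := step_low c l lc (ltW lc') (lexx _).
have := step_high l c' (lexx _) (ltW c'l).
by lra.
Qed.

Lemma tail_mass_ge0 (R : rcfType) (l : R) n f a : 0 < l -> l < 1 -> l <= a ->
  0 <= tail_mass l n f a.
Proof.
move=> l_gt0 l_lt1 la; case: n => [|n] //=.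
rewrite addr_ge0 // mulr_ge0 ?sqr_ge0 ?subr_ge0 ?sumr_ge0 //.
- by rewrite ler_pXn2r // nnegrE ltW // (lt_le_trans l_gt0).
- by rewrite expr_le1 ?ltW.
- by move=> i _; rewrite sqr_ge0.
Qed.

(* Move along the path on which the remaining masses of [f] and [g] keep a
   constant ratio; crossing one cell gains at least the geometric mean of the
   two masses spent there, since
   (a b - a' b')^2 >= (a^2 - a'^2) (b^2 - b'^2). *)
Lemma tail_mass_le_integral (R : rcfType) (l : R) n m f g M a b s :
  0 < l -> l < 1 ->
  (forall i, 0 <= f i) -> (forall i, 0 <= g i) -> (forall k, 0 <= M k) ->
  l <= a <= 1 -> l <= b <= 1 ->
  (forall i j, f i * g j <= M (i + j)%N) ->
  (forall i j, l * (f i * g j) <= M (i + j).+1) ->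
  0 <= s -> s ^+ 2 = tail_mass l n f a * tail_mass l m g b ->
  s <= tail_integral l (n + m) M (a * b).
Proof.
move=> l_gt0 l_lt1; have [N leN] := ubnP (n + m).
elim: N => // N IH in n m f g M a b s leN *.
(* By symmetry, let [f] be the one that leaves its current cell first when both masses shrink by the
   same proportion. *)
wlog ratio_le : n m f g a b leN /
    f 0%N ^+ 2 * (a ^+ 2 - l ^+ 2) * tail_mass l m g b <=
    g 0%N ^+ 2 * (b ^+ 2 - l ^+ 2) * tail_mass l n f a.
  move=> wl f0 g0 M0 ha hb fgM fgM1 s0 Es.
  case: (leP (f 0%N ^+ 2 * (a ^+ 2 - l ^+ 2) * tail_mass l m g b)
             (g 0%N ^+ 2 * (b ^+ 2 - l ^+ 2) * tail_mass l n f a)) => [le|/ltW le].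
    exact: (wl n m f g a b).
  rewrite addnC [a * b]mulrC; apply: (wl m n g f b a) => //.
  - by rewrite addnC.
  - by move=> i j; rewrite mulrC addnC.
  - by move=> i j; rewrite (mulrC (g i)) addnC.
  - by rewrite Es mulrC.
move=> f0 g0 M0 /andP[la a1] /andP[lb b1] fgM fgM1 s0 Es.
set F := tail_mass l n f a in ratio_le Es.
set H := tail_mass l m g b in ratio_le Es.
have F0 : 0 <= F by apply: tail_mass_ge0.
have H0 : 0 <= H by apply: tail_mass_ge0.
have [s_eq0|s_neq0] := eqVneq s 0; first by rewrite s_eq0 tail_integral_ge0.
have FH_neq0 : F * H != 0 by rewrite -Es expf_neq0.
have /andP[F_gt0 H_gt0] : (0 < F) && (0 < H).
  by rewrite !lt0r F0 H0 !andbT -negb_or -mulf_eq0.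
case: n => [|n] in leN F F0 F_gt0 FH_neq0 Es ratio_le *.
  by rewrite /F /= ltxx in F_gt0.
case: m => [|m] in leN H H0 H_gt0 FH_neq0 Es ratio_le *.
  by rewrite /H /= ltxx in H_gt0.
have a_gt0 := lt_le_trans l_gt0 la; have b_gt0 := lt_le_trans l_gt0 lb.
have la2 : l ^+ 2 <= a ^+ 2 by rewrite ler_pXn2r // nnegrE ltW.
have lb2 : l ^+ 2 <= b ^+ 2 by rewrite ler_pXn2r // nnegrE ltW.
set dF := f 0%N ^+ 2 * (a ^+ 2 - l ^+ 2) in ratio_le.
set dH := g 0%N ^+ 2 * (b ^+ 2 - l ^+ 2) in ratio_le.
have dF0 : 0 <= dF by rewrite mulr_ge0 ?sqr_ge0 ?subr_ge0.
(* The fraction of the mass of [f] that its current cell holds; [a] moves down to [l], and [g] has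
   to lose the same fraction of its mass. *)
pose t := dF / F.
have t0 : 0 <= t by rewrite divr_ge0.
have EdF : dF = t * F by rewrite /t divfK // gt_eqF.
have t1 : t <= 1.
  rewrite ler_pdivrMr // mul1r /F /= lerDl mulr_ge0 ?sumr_ge0 //.
    by rewrite subr_ge0 expr_le1 ?ltW.
  by move=> i _; rewrite sqr_ge0.
have tH_le : t * H <= dH.
  by rewrite -(ler_pM2r F_gt0) mulrAC -EdF.
have [b' [lb' b'b Eb']] : exists b', [/\ l <= b', b' <= b &
    g 0%N ^+ 2 * (b ^+ 2 - b' ^+ 2) = t * H].
  have [g00|g0_neq0] := eqVneq (g 0%N) 0.
    exists b; split=> //; apply/eqP; rewrite subrr mulr0 eq_le mulr_ge0 //=.
    by rewrite (le_trans tH_le) // /dH g00 expr0n mul0r.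
  have g2_gt0 : 0 < g 0%N ^+ 2 by rewrite exprn_even_gt0 ?g0_neq0 ?orbT.
  (* [z] solves [g 0 ^ 2 * (b ^ 2 - z) = t * H]; [tH_le] keeps its root inside the current cell of
     [g]. *)
  pose z := b ^+ 2 - t * H / g 0%N ^+ 2.
  have lz : l ^+ 2 <= z.
    by rewrite lerBrDl -lerBrDr ler_pdivrMr // [leRHS]mulrC.
  exists (Num.sqrt z); split.
  - by rewrite -(ger0_norm (ltW l_gt0)) -sqrtr_sqr ler_wsqrtr.
  - rewrite -[leRHS](ger0_norm (ltW b_gt0)) -sqrtr_sqr ler_wsqrtr //.
    by rewrite gerBl divr_ge0 ?sqr_ge0 // mulr_ge0.
  rewrite sqr_sqrtr ?(le_trans (sqr_ge0 l)) //.
  by rewrite /z; field.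
have l2_le : l ^+ 2 <= l * b' by rewrite expr2 ler_pM2l.
have lb'_le : l * b' <= a * b.
  by rewrite ler_pM // ltW // (lt_le_trans l_gt0).
have step : (a * b - l * b') * (f 0%N * g 0%N) <=
    tail_integral l (n + m).+2 M (a * b) -
    tail_integral l (n + m).+2 M (l * b').
  by apply: tail_integral_increment => //; rewrite mulr_ile1 // ltW.
have gain : t * s <= (a * b - l * b') * (f 0%N * g 0%N).
  have lhs0 : 0 <= a * b - l * b' by rewrite subr_ge0.
  rewrite -(ler_pXn2r (ltn0Sn 1)) ?nnegrE ?(mulr_ge0 t0 s0) //; last first.
    by rewrite mulr_ge0 // mulr_ge0.
  have -> : (t * s) ^+ 2 = dF * (g 0%N ^+ 2 * (b ^+ 2 - b' ^+ 2)).
    by rewrite exprMn Es Eb' EdF; ring.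
  rewrite -subr_ge0 /dF.
  have -> : ((a * b - l * b') * (f 0%N * g 0%N)) ^+ 2 -
      f 0%N ^+ 2 * (a ^+ 2 - l ^+ 2) * (g 0%N ^+ 2 * (b ^+ 2 - b' ^+ 2)) =
      (f 0%N * g 0%N * (a * b' - l * b)) ^+ 2 by ring.
  exact: sqr_ge0.
(* The first cell of [f] is used up, so [f] and [M] shift by one index and [a] restarts at 1. Both
   masses are scaled by [1 - t], hence so is their geometric mean. *)
have rest : (1 - t) * s <=
    tail_integral l (n + m.+1) (fun k => M k.+1) (1 * b').
  apply: (IH n m.+1 (fun i => f i.+1) g) => //.
  - by rewrite lexx ltW.
  - by rewrite lb' (le_trans b'b).
  - by rewrite mulr_ge0 ?subr_ge0.
  have -> : tail_mass l n (fun i => f i.+1) 1 = (1 - t) * F.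
    by rewrite tail_mass1 [RHS]mulrBl mul1r -EdF /F /= -/dF [RHS]addrC addKr.
  have -> : tail_mass l m.+1 g b' = (1 - t) * H.
    by rewrite mulrBl mul1r -Eb' /H /=; ring.
  by rewrite exprMn Es; ring.
rewrite addSn addnS.
have : tail_integral l (n + m).+2 M (l * b') =
    tail_integral l (n + m.+1) (fun k => M k.+1) (1 * b').
  rewrite tail_integralS //; last first.
    by rewrite ger_pMr // (le_trans b'b).
  by rewrite addnS mulrAC divff ?mul1r // gt_eqF.
by lra.
Qed.

(** Take [l = q / p] and integrate [M / p] up to 1. The masses carry a factor [1 - l ^ 2] and the
    integral a factor [1 - l]; the quotient [1 + l] is [(p + q) / p]. *)
Lemma two_point_prekopa_leindler (R : rcfType) (p q s : R) n m f g M :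
  0 < q -> q <= p ->
  (forall i, 0 <= f i) -> (forall i, 0 <= g i) -> (forall k, 0 <= M k) ->
  (forall i j, p * (f i * g j) <= M (i + j)%N) ->
  (forall i j, q * (f i * g j) <= M (i + j).+1) ->
  0 <= s -> s ^+ 2 = (\sum_(i < n) f i ^+ 2) * (\sum_(j < m) g j ^+ 2) ->
  (p + q) * s <= \sum_(k < n + m) M k.
Proof.
move=> q_gt0 qp f0 g0 M0 pM qM s0 Es.
have p_gt0 := lt_le_trans q_gt0 qp.
have bound q' : 0 < q' -> q' < p -> q' <= q ->
    (p + q') * s <= \sum_(k < n + m) M k.
  move=> q'_gt0 q'p q'q; pose l := q' / p.
  have l_gt0 : 0 < l by rewrite divr_gt0.
  have l_lt1 : l < 1 by rewrite ltr_pdivrMr // mul1r.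
  have l2_lt1 : 0 < 1 - l ^+ 2 by rewrite subr_gt0 expr_lt1 ?ltW.
  have : (1 - l ^+ 2) * s <=
      tail_integral l (n + m) (fun k => M k / p) (1 * 1).
    apply: (tail_mass_le_integral _ _ n m f g) => //.
    - by move=> k; rewrite divr_ge0 // ltW.
    - by rewrite lexx ltW.
    - by rewrite lexx ltW.
    - by move=> i j; rewrite ler_pdivlMr // mulrC.
    - move=> i j; rewrite ler_pdivlMr // /l mulrAC divfK ?gt_eqF //.
      by apply: le_trans (qM i j); rewrite ler_wpM2r ?mulr_ge0.
    - by rewrite mulr_ge0 // ltW.
    by rewrite !tail_mass1 exprMn Es; ring.
  rewrite mul1r tail_integral1 // -mulr_suml.
  have -> : 1 - l ^+ 2 = (1 - l) * (1 + l) by ring.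
  rewrite -mulrA ler_pM2l ?subr_gt0 // ler_pdivlMr //.
  by have -> : (1 + l) * s * p = (p + q') * s by rewrite /l; field; rewrite gt_eqF.
case: (ltrP q p) => [lt_qp|le_pq]; first exact: bound.
have {le_pq qp} Eqp : q = p by apply/eqP; rewrite eq_le qp.
(* For q = p the path argument degenerates; let q' tend to p from below. *)
rewrite leNgt; apply/negP; set S := \sum_(_ < _) _ => lt_S.
have s_gt0 : 0 < s.
  rewrite lt0r s0 andbT; apply/negP => /eqP s00.
  by move: lt_S; rewrite s00 mulr0 ltNge sumr_ge0.
(* A valid bound for [q'] forces [q' <= r], which the midpoint of [r] and [p] violates; the maximum
   with [p / 2] keeps [q'] positive. *)
pose r := S / s - p.
have r_lt : r < p by rewrite ltrBlDr ltr_pdivrMr // -{2}Eqp.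
have := bound (Num.max (p / 2%:R) ((r + p) / 2%:R)).
rewrite lt_max divr_gt0 // => /(_ isT).
have max_lt : Num.max (p / 2%:R) ((r + p) / 2%:R) < p.
  by rewrite gt_max; apply/andP; split; lra.
rewrite Eqp max_lt (ltW max_lt) => /(_ isT isT).
rewrite -ler_pdivlMr // -lerBrDl -/r ge_max => /andP[_]; lra.
Qed.

(** * Tripling *)

Lemma sumsetP (G : zmodType) (A B : {fset G}) (u : G) :
  reflect (exists a b, [/\ a \in A, b \in B & u = a + b]) (u \in sumset A B).
Proof.
apply: (iffP (imfset2P _ _ _ _ _)) => [[a aA [b bB ->]]|[a [b [aA bB ->]]]].
  by exists a, b.
by exists a => //; exists b.
Qed.

Lemma mem_sumset (G : zmodType) (A B : {fset G}) (a b : G) :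
  a \in A -> b \in B -> a + b \in sumset A B.
Proof. by move=> aA bB; apply/sumsetP; exists a, b. Qed.

Lemma sumsetC (G : zmodType) (A B : {fset G}) : sumset A B = sumset B A.
Proof.
by apply/fsetP => u; apply/sumsetP/sumsetP => -[a [b [? ? ->]]];
  exists b, a; rewrite addrC.
Qed.

Lemma sumsetSS (G : zmodType) (A A' B B' : {fset G}) :
  A `<=` A' -> B `<=` B' -> sumset A B `<=` sumset A' B'.
Proof.
move=> /fsubsetP sA /fsubsetP sB; apply/fsubsetP => u.
by move=> /sumsetP[a [b [/sA aA /sB bB ->]]]; apply: mem_sumset.
Qed.

Lemma sumset0 (G : zmodType) (A : {fset G}) : sumset A fset0 = fset0.
Proof. by apply/fsetP => u; apply/sumsetP; rewrite in_fset0 => -[a [b []]]. Qed.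

Lemma card_sumset1 (G : zmodType) (A : {fset G}) (g : G) :
  #|` sumset A [fset g]| = #|` A|.
Proof.
have -> : sumset A [fset g] = [fset a + g | a in A].
  apply/fsetP => u; apply/sumsetP/imfsetP => [[a [b [aA]]]|[a aA ->]].
    by rewrite in_fset1 => /eqP -> ->; exists a.
  by exists a, g; rewrite in_fset1.
by rewrite card_imfset //; apply: addIr.
Qed.

Lemma card_sumset_gel (G : zmodType) (A B : {fset G}) (b : G) :
  b \in B -> (#|` A| <= #|` sumset A B|)%N.
Proof.
by move=> bB; rewrite -(card_sumset1 _ A b) fsubset_leq_card // sumsetSS ?fsub1set.
Qed.

Lemma card_sumset_ger (G : zmodType) (A B : {fset G}) (a : G) :
  a \in A -> (#|` B| <= #|` sumset A B|)%N.
Proof. by rewrite sumsetC; apply: card_sumset_gel. Qed.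

(** * Cutting finite sets into cosets *)

Lemma coset_partP (G : zmodType) (H : set G) (x u : G) (U : {fset G}) :
  reflect (u \in U /\ H (u - x)) (u \in coset_part H x U).
Proof.
rewrite /coset_part !inE /=.
by apply: (iffP andP) => -[uU Hu]; split=> //; apply/asboolP.
Qed.

Lemma coset_part_sub (G : zmodType) (H : set G) (x : G) (U : {fset G}) :
  coset_part H x U `<=` U.
Proof. by apply/fsubsetP => u /coset_partP[]. Qed.

Lemma coset_partS (G : zmodType) (H : set G) (x : G) (U V : {fset G}) :
  V `<=` U -> coset_part H x V `<=` coset_part H x U.
Proof.
move=> /fsubsetP sVU; apply/fsubsetP => u /coset_partP[/sVU uU Hu].
exact/coset_partP.
Qed.

Lemma subgroupN (G : zmodType) (H : set G) u : is_subgroup H -> H u -> H (- u).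
Proof. by move=> [H0 HB] Hu; rewrite -sub0r; apply: HB. Qed.

Lemma subgroupD (G : zmodType) (H : set G) u v :
  is_subgroup H -> H u -> H v -> H (u + v).
Proof.
move=> sH Hu Hv; rewrite -[v]opprK; apply: (sH.2) => //; exact: subgroupN.
Qed.

Lemma coset_part_sumset (G : zmodType) (H : set G) (x y : G) (A B : {fset G}) :
  is_subgroup H ->
  sumset (coset_part H x A) (coset_part H y B) `<=`
  coset_part H (x + y) (sumset A B).
Proof.
move=> sH; apply/fsubsetP => u /sumsetP[a [b [/coset_partP[aA Ha]]]].
move=> /coset_partP[bB Hb] ->; apply/coset_partP; split; first exact: mem_sumset.
by rewrite opprD addrACA; apply: subgroupD.
Qed.

Lemma coset_part_setD (G : zmodType) (H : set G) (x y : G) (A : {fset G}) :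
  is_subgroup H -> ~ H (x - y) ->
  coset_part H x (A `\` coset_part H y A) = coset_part H x A.
Proof.
move=> sH Hxy; apply/fsetP => u; apply/coset_partP/coset_partP => -[].
  by rewrite in_fsetD => /andP[].
move=> uA Hux; split=> //; rewrite in_fsetD uA andbT; apply/coset_partP => -[_ Huy].
by apply: Hxy; have := sH.2 _ _ Huy Hux; rewrite opprB addrC addrA subrK.
Qed.

Lemma card_coset_partD (G : zmodType) (H : set G) (x : G) (A : {fset G}) :
  #|` A| = (#|` coset_part H x A| + #|` A `\` coset_part H x A|)%N.
Proof.
rewrite -(cardfsID (coset_part H x A) A); congr (_ + _)%N.
by rewrite (fsetIidPr _) // coset_part_sub.
Qed.

(** Translation by [c] is injective on cosets, so the hypotheses can be summed. The induction
    removes one coset from [A] and its translate from [X], which leaves the other coset parts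
    unchanged. *)
Lemma le_card_cosets (R : numDomainType) (G : zmodType) (K : set G) (c : G)
    (k : R) (A X : {fset G}) : is_subgroup K ->
  (forall a, a \in A ->
    k * #|` coset_part K a A|%:R <= #|` coset_part K (a + c) X|%:R) ->
  k * #|` A|%:R <= #|` X|%:R.
Proof.
move=> sK; have [n] := ubnP #|` A|; elim: n => // n IH in A X * => leA kAX.
have [->|[a aA]] := fset_0Vmem A; first by rewrite cardfs0 mulr0 ler0n.
have Kaa : K (a - a) by rewrite subrr; apply: (sK.1).
have aKa : a \in coset_part K a A by apply/coset_partP.
rewrite (card_coset_partD _ K a A) (card_coset_partD _ K (a + c) X).
rewrite !natrD mulrDr lerD ?kAX //.
apply: IH.
  move: leA; rewrite (card_coset_partD _ K a A).
  have : (0 < #|` coset_part K a A|)%N by rewrite cardfs_gt0; apply/fset0Pn; exists a.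
  by lia.
move=> a'; rewrite in_fsetD => /andP[a'Ka a'A].
have nK : ~ K (a' - a) by move=> Ka; case/negP: a'Ka; apply/coset_partP.
rewrite !coset_part_setD ?kAX //.
by rewrite opprD addrACA subrr addr0.
Qed.

Lemma card_le_sum_cosets (G : zmodType) (H : set G) (x : nat -> G) n
    (A : {fset G}) :
  (forall u, u \in A -> exists2 i, (i < n)%N & H (u - x i)) ->
  (#|` A| <= \sum_(i < n) #|` coset_part H (x i) A|)%N.
Proof.
elim: n A => [|n IH] A covA.
  have [->|[a /covA[] //]] := fset_0Vmem A; by rewrite cardfs0.
rewrite big_ord_recr /= addnC (card_coset_partD _ H (x n)) leq_add2l.
apply: leq_trans (IH _ _) _.
  move=> u; rewrite in_fsetD => /andP[unx uA].
  have [i] := covA u uA; rewrite ltnS leq_eqVlt => /orP[/eqP ->|lt_in] Hu.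
    by case/negP: unx; apply/coset_partP.
  by exists i.
apply: leq_sum => i _.
by rewrite fsubset_leq_card // coset_partS // fsubsetDl.
Qed.

Lemma sum_cosets_le_card (G : zmodType) (H : set G) (x : nat -> G) n
    (X : {fset G}) : is_subgroup H ->
  (forall i j, (i < j)%N -> ~ H (x i - x j)) ->
  (\sum_(i < n) #|` coset_part H (x i) X| <= #|` X|)%N.
Proof.
move=> sH nH; elim: n X => [|n IH] X; first by rewrite big_ord0.
rewrite big_ord_recr /= addnC (card_coset_partD _ H (x n) X) leq_add2l.
apply: leq_trans (IH _); apply: leq_sum => i _.
by rewrite coset_part_setD //; apply: nH.
Qed.

(** * The tripling bound, from a line of cosets to arbitrary sets *)

Definition tripling_bound {G : zmodType} (V A B : {fset G}) : Prop :=
  (#|` V| ^ 2 * (#|` A| * #|` B|) <= #|` sumset (sumset A B) V| ^ 2)%N.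

Lemma tripling_boundP (R : rcfType) (G : zmodType) (V A B : {fset G}) :
  tripling_bound V A B <->
  #|` V|%:R * (Num.sqrt #|` A|%:R * Num.sqrt #|` B|%:R) <=
    #|` sumset (sumset A B) V|%:R :> R.
Proof.
rewrite /tripling_bound.
rewrite -(ler_pXn2r (ltn0Sn 1)) ?nnegrE ?mulr_ge0 ?sqrtr_ge0 ?ler0n //.
by rewrite !exprMn !sqr_sqrtr ?ler0n // -!natrX -!natrM ler_nat.
Qed.

(** The subgroup H + Zv, with the integer coefficient of [v] written as a difference [n - m] of
    naturals. *)
Definition line_span {G : zmodType} (H : set G) (v : G) : set G :=
  fun u => exists m n : nat, H (u + v *+ m - v *+ n).

Lemma line_span_subgroup (G : zmodType) (H : set G) (v : G) :
  is_subgroup H -> is_subgroup (line_span H v).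
Proof.
move=> sH; split; first by exists 0%N, 0%N; rewrite addrK; apply: (sH.1).
move=> u w [m [n Hu]] [m' [n' Hw]]; exists (m + n')%N, (n + m')%N.
have := sH.2 _ _ Hu Hw; rewrite !opprD !opprK.
by rewrite (AC (3*3) ((1*4)*(2*6)*(3*5))) /= -opprD -!mulrnDr.
Qed.

Lemma line_span_cover (G : zmodType) (H : set G) (v a : G) (A : {fset G}) :
  (forall u, u \in A -> line_span H v (u - a)) ->
  exists a0 n, forall u, u \in A ->
    exists2 i, (i < n)%N & H (u - (a0 + v *+ i)).
Proof.
move=> spanA.
have /choice[e He] u : exists e : nat * nat,
    u \in A -> H (u - a + v *+ e.1 - v *+ e.2).
  have [uA|_] := boolP (u \in A); last by exists (0, 0)%N.
  by have [m [n ?]] := spanA u uA; exists (m, n).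
pose m := (\max_(u <- A) (e u).1)%N; pose n := (\max_(u <- A) (e u).2)%N.
(* Moving the base point back by the largest [m] in use makes all coefficients nonnegative. *)
exists (a - v *+ m), (m + n).+1 => u uA.
have le_m : ((e u).1 <= m)%N by apply: (leq_bigmax_seq (F := fun u => (e u).1)).
have le_n : ((e u).2 <= n)%N by apply: (leq_bigmax_seq (F := fun u => (e u).2)).
exists (m - (e u).1 + (e u).2)%N.
  by rewrite ltnS leq_add // leq_subr.
have := He u uA; congr (H _).
rewrite mulrnDr mulrnBr // !opprD !opprK.
by rewrite !addrA addrK.
Qed.

Lemma tripling_bound_line (R : rcfType) (G : zmodType) (H : set G)
    (x y a b : G) (V A B : {fset G}) :
  is_subgroup H -> (forall n, (0 < n)%N -> ~ H ((x - y) *+ n)) ->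
  (forall u, u \in V -> H (u - x) \/ H (u - y)) ->
  (0 < #|` coset_part H x V| <= #|` coset_part H y V|)%N ->
  (forall A' B', tripling_bound (coset_part H x V) A' B') ->
  (forall A' B', tripling_bound (coset_part H y V) A' B') ->
  (forall u, u \in A -> line_span H (x - y) (u - a)) ->
  (forall u, u \in B -> line_span H (x - y) (u - b)) ->
  tripling_bound V A B.
Proof.
move=> sH inf covV /andP[q_gt0 qp] tbx tby.
move=> /line_span_cover[a0 [n covA]] /line_span_cover[b0 [m covB]].
set v := x - y in inf covA covB.
set X := sumset (sumset A B) V.
pose part (C : {fset G}) c i := coset_part H (c + v *+ i) C.
(* Square roots, so that the sums of [f i ^ 2] and [g j ^ 2] count [A] and [B]. The cosets of [X]
   are indexed from [y], so the part of [V] near [y] adds no shift. *)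
pose f i : R := Num.sqrt #|` part A a0 i|%:R.
pose g i : R := Num.sqrt #|` part B b0 i|%:R.
pose M k : R := #|` part X (a0 + b0 + y) k|%:R.
have card_sum C c k : (forall u, u \in C ->
      exists2 i, (i < k)%N & H (u - (c + v *+ i))) ->
    #|` C|%:R <= \sum_(i < k) (Num.sqrt #|` part C c i|%:R) ^+ 2 :> R.
  move=> covC; under eq_bigr do rewrite sqr_sqrtr ?ler0n //.
  by rewrite -natr_sum ler_nat; exact: (card_le_sum_cosets _ _ (fun i => c + v *+ i)).
(* Infinite order of [x - y] modulo [H] makes these cosets pairwise distinct. *)
have sumM : \sum_(k < n + m) M k <= #|` X|%:R.
  rewrite -natr_sum ler_nat.
  apply: (sum_cosets_le_card _ _ (fun k => a0 + b0 + y + v *+ k)) => //.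
  move=> i j lt_ij Hij; apply: (inf (j - i)%N); first by rewrite subn_gt0.
  have := subgroupN _ _ _ sH Hij.
  by rewrite opprB [X in _ + X]opprD addrACA subrr add0r mulrnBr // ltnW.
have M_ge i j k z : a0 + v *+ i + (b0 + v *+ j) + z = a0 + b0 + y + v *+ k ->
    (forall A' B', tripling_bound (coset_part H z V) A' B') ->
    #|` coset_part H z V|%:R * (f i * g j) <= M k.
  move=> Ez tbz; apply: le_trans (proj1 (tripling_boundP R _ _ _ _) (tbz _ _)) _.
  rewrite ler_nat fsubset_leq_card // /part -Ez.
  apply: fsubset_trans (coset_part_sumset _ _ _ _ _ _ sH).
  by apply: sumsetSS => //; apply: coset_part_sumset.
have cardV : (#|` V| <= #|` coset_part H y V| + #|` coset_part H x V|)%N.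
  rewrite (card_coset_partD _ H x) addnC leq_add2r fsubset_leq_card //.
  apply/fsubsetP => u; rewrite in_fsetD => /andP[unx uV].
  case: (covV u uV) => Hu; last exact/coset_partP.
  by case/negP: unx; apply/coset_partP.
pose s := Num.sqrt ((\sum_(i < n) f i ^+ 2) * (\sum_(j < m) g j ^+ 2)).
have sum_ge0 k (h : nat -> R) : 0 <= \sum_(i < k) h i ^+ 2.
  by apply: sumr_ge0 => i _; rewrite sqr_ge0.
apply/(tripling_boundP R); rewrite -/X.
apply: le_trans sumM.
apply: (@le_trans _ _
    ((#|` coset_part H y V|%:R + #|` coset_part H x V|%:R) * s)).
  rewrite ler_pM ?ler0n ?mulr_ge0 ?sqrtr_ge0 -?natrD ?ler_nat //.
  rewrite /s -sqrtrM ?ler0n // ler_wsqrtr // ler_pM ?ler0n //; exact: card_sum.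
apply: (two_point_prekopa_leindler _ _ _ _ n m f g) => //.
- by rewrite ltr0n.
- by rewrite ler_nat.
- by move=> i; apply: sqrtr_ge0.
- by move=> i; apply: sqrtr_ge0.
- by move=> i j; apply: M_ge => //; rewrite mulrnDr (AC (2*2*1) (1*3*5*(2*4))).
- move=> i j; apply: M_ge => //.
  (* Since [x = v + y], the part of [V] near [x] shifts the index by one. *)
  rewrite -[x](subrK y) -/v mulrSr mulrnDr.
  by rewrite (AC (2*2*2) (1*3*6*((2*4)*5))).
- exact: sqrtr_ge0.
by rewrite sqr_sqrtr // mulr_ge0.
Qed.

Lemma exists_largest_coset (G : zmodType) (K : set G) (A : {fset G}) :
  A != fset0 -> exists2 a, a \in A & forall a', a' \in A ->
    (#|` coset_part K a' A| <= #|` coset_part K a A|)%N.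
Proof.
case/fset0Pn => a aA.
have [b _ maxb] := arg_maxnP (P := xpredT)
  (fun u : A => #|` coset_part K (val u) A|) (i0 := [` aA]) isT.
by exists (val b) => [|a' a'A]; [exact: valP|exact: (maxb [` a'A])].
Qed.

(** Let [A_a] and [B_b] be largest coset parts. Each part [A_c] satisfies |A_c + B_b + V| >= |V|
    sqrt(|A_c| |B_b|) >= |A_c| |V| sqrt(|B_b| / |A_a|), and these sumsets lie in distinct cosets
    because [V] lies in one. Summing over c bounds |A + B + V| below by |A| |V| sqrt(|B_b| /
    |A_a|). *)
Lemma tripling_bound_of_cosets (R : rcfType) (G : zmodType) (K : set G) (y : G)
    (V : {fset G}) : is_subgroup K -> (forall u, u \in V -> K (u - y)) ->
  (forall (A B : {fset G}) a b, (forall u, u \in A -> K (u - a)) ->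
     (forall u, u \in B -> K (u - b)) -> tripling_bound V A B) ->
  forall A B, tripling_bound V A B.
Proof.
move=> sK VK tbK A B.
have [->|A0] := eqVneq A fset0; first by rewrite /tripling_bound cardfs0 muln0.
have [->|B0] := eqVneq B fset0; first by rewrite /tripling_bound cardfs0 !muln0.
have [a aA maxa] := exists_largest_coset _ K _ A0.
have [b bB maxb] := exists_largest_coset _ K _ B0.
pose root (C : {fset G}) c : R := Num.sqrt #|` coset_part K c C|%:R.
have root_gt0 (C : {fset G}) c : c \in C -> 0 < root C c.
  move=> cC; rewrite sqrtr_gt0 ltr0n cardfs_gt0; apply/fset0Pn; exists c.
  by apply/coset_partP; rewrite subrr; split => //; apply: (sK.1).
have half (C D : {fset G}) (c e : G) : c \in C -> e \in D ->
    (forall c', c' \in C -> (#|` coset_part K c' C| <= #|` coset_part K c C|)%N) ->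
    #|` V|%:R * root D e / root C c * #|` C|%:R <=
      #|` sumset (sumset C D) V|%:R.
  move=> cC eD maxc; apply: (le_card_cosets _ _ K (e + y)) => // c' c'C.
  have tb : tripling_bound V (coset_part K c' C) (coset_part K e D).
    by apply: (tbK _ _ c' e) => u /coset_partP[].
  move/(tripling_boundP R): tb; rewrite -/(root C c') -/(root D e) => tb.
  apply: le_trans (le_trans tb _).
    rewrite -[X in _ * X](@sqr_sqrtr R) ?ler0n // -/(root C c').
    rewrite mulrAC ler_pdivrMr ?root_gt0 // expr2 -!mulrA ler_wpM2l ?ler0n //.
    rewrite mulrC -!mulrA ler_wpM2l ?sqrtr_ge0 // mulrC ler_wpM2l ?sqrtr_ge0 //.
    by rewrite ler_wsqrtr // ler_nat maxc.
  rewrite ler_nat fsubset_leq_card // addrA.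
  apply: fsubset_trans (coset_part_sumset _ _ _ _ _ _ sK).
  apply: sumsetSS; first exact: coset_part_sumset.
  by apply/fsubsetP => u uV; apply/coset_partP; split; last exact: VK.
(* In the product of this bound with its mirror image the two square root quotients cancel. *)
have := half A B a b aA bB maxa; have := half B A b a bB aA maxb.
rewrite (sumsetC _ B A); set X := sumset _ _ => hB hA.
rewrite /tripling_bound -/X -(ler_nat R) natrM [leRHS]natrX expr2.
apply: le_trans (ler_pM _ _ hA hB).
- rewrite natrX natrM le_eqVlt; apply/orP; left; apply/eqP.
  by field; rewrite !gt_eqF ?root_gt0.
- by rewrite !mulr_ge0 ?invr_ge0 ?sqrtr_ge0 ?ler0n.
- by rewrite !mulr_ge0 ?invr_ge0 ?sqrtr_ge0 ?ler0n.
Qed.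

Lemma tripling_bound_two_cosets (R : rcfType) (G : zmodType) (H : set G)
    (x y : G) (V : {fset G}) :
  is_subgroup H -> (forall n, (0 < n)%N -> ~ H ((x - y) *+ n)) ->
  (forall u, u \in V -> H (u - x) \/ H (u - y)) ->
  (forall A B, tripling_bound (coset_part H x V) A B) ->
  (forall A B, tripling_bound (coset_part H y V) A B) ->
  forall A B, tripling_bound V A B.
Proof.
move=> sH; wlog qp : x y / (#|` coset_part H x V| <= #|` coset_part H y V|)%N.
  move=> wl inf covV tbx tby.
  case: (leqP #|` coset_part H x V| #|` coset_part H y V|) => [le|/ltnW le].
    exact: (wl x y).
  apply: (wl y x) => // [n n0|u /covV[]]; [|by right|by left].
  rewrite -opprB mulNrn => /(subgroupN _ _ _ sH); rewrite opprK; exact: inf.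
move=> inf covV tbx tby A B.
(* The functional inequality needs [q > 0]; if the smaller part is empty, [V] is just the other
   part. *)
have [Vx0|Vx0] := posnP #|` coset_part H x V|.
  suff <- : coset_part H y V = V by apply: tby.
  apply/eqP; rewrite eqEfsubset coset_part_sub; apply/fsubsetP => u uV.
  case: (covV u uV) => Hu; last exact/coset_partP.
  have : u \in coset_part H x V by apply/coset_partP.
  by rewrite (cardfs0_eq Vx0) in_fset0.
apply: (tripling_bound_of_cosets R _ (line_span H (x - y)) y).
- exact: line_span_subgroup.
- move=> u /covV[] Hu; last by exists 0%N, 0%N; rewrite addrK.
  by exists 0%N, 1%N; rewrite addr0 mulr1n opprB addrA subrK.
move=> A' B' a b spanA spanB.
by apply: (tripling_bound_line R _ H x y a b) => //; rewrite Vx0.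
Qed.

(** Subsets are carried through the induction because a coset part of [V] lies in the same coset
    part of [U]. For a single point, |A + B| is at least both |A| and |B|. *)
Lemma quasicube_tripling_bound (R : rcfType) (G : zmodType) d (U V : {fset G}) :
  quasicube d U -> V `<=` U -> forall A B, tripling_bound V A B.
Proof.
move=> cubeU; elim: cubeU V => {d U} [g|d U H x y sH _ _ covU _ IHx _ IHy inf] V sVU.
  move=> A B; rewrite fsubset1 in sVU; case/orP: sVU => /eqP ->; last first.
    by rewrite /tripling_bound cardfs0.
  rewrite /tripling_bound cardfs1 exp1n mul1n card_sumset1.
  have [->|[a aA]] := fset_0Vmem A; first by rewrite cardfs0.
  have [->|[b bB]] := fset_0Vmem B; first by rewrite cardfs0 muln0.
  by rewrite leq_mul ?(card_sumset_gel _ _ _ b) ?(card_sumset_ger _ _ _ a).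
apply: (tripling_bound_two_cosets R _ H x y) => //.
- by move=> u /(fsubsetP sVU) /covU.
- by apply: IHx; apply: coset_partS.
- by apply: IHy; apply: coset_partS.
Qed.

Lemma card_quasicube (G : zmodType) d (U : {fset G}) :
  quasicube d U -> #|` U| = (2 ^ d)%N.
Proof.
elim=> {d U} [g|d U H x y sH _ nH covU _ IHx _ IHy _]; first by rewrite cardfs1.
rewrite (card_coset_partD _ H x) IHx expnS mul2n -addnn; congr (_ + _)%N.
rewrite -IHy; congr #|` _|; apply/fsetP => u; rewrite in_fsetD.
apply/andP/coset_partP => [[unx uU]|[uU Hu]].
  by split=> //; case: (covU u uU) => // Hu; case/negP: unx; apply/coset_partP.
split=> //; apply/coset_partP => -[_ Hux]; apply: nH.
by have := sH.2 _ _ Hu Hux; rewrite opprB addrC addrA subrK.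
Qed.

(** * Doubling *)

(** Cross-multiplying the minimality of |X + B| / |X| makes it hold for empty [Z] too. *)
Lemma exists_min_expansion (G : zmodType) (A B : {fset G}) : A != fset0 ->
  exists2 X : {fset G}, (X != fset0) && (X `<=` A) &
    forall Z : {fset G}, Z `<=` A ->
      (#|` sumset X B| * #|` Z| <= #|` sumset Z B| * #|` X|)%N.
Proof.
move=> A0; pose F := fpowerset A.
have AF : A \in F by rewrite fpowersetE fsubset_refl.
have [X X0 minX] := @arg_minP _ _ F [` AF] (fun Z => val Z != fset0)
  (fun Z => #|` sumset (val Z) B|%:R / #|` val Z|%:R : rat) A0.
have sXA : val X `<=` A by rewrite -fpowersetE (valP X).
exists (val X) => [|Z sZA]; first by rewrite X0.
have [->|Z0] := eqVneq Z fset0; first by rewrite cardfs0 muln0.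
have ZF : Z \in F by rewrite fpowersetE.
have := minX [` ZF] Z0; rewrite /= ler_pdivrMr ?ltr0n ?cardfs_gt0 //.
by rewrite mulrAC ler_pdivlMr ?ltr0n ?cardfs_gt0 // -!natrM ler_nat.
Qed.

(* Petridis: adjoin an element c to C. Writing Z for the set of x in X with
   x + c in X + C, the translate Z + B + c is already contained in X + B + C,
   and minimality of X bounds |Z + B| from below. *)
Lemma petridis (G : zmodType) (X B C : {fset G}) :
  (forall Z : {fset G}, Z `<=` X ->
     (#|` sumset X B| * #|` Z| <= #|` sumset Z B| * #|` X|)%N) ->
  (#|` sumset (sumset X B) C| * #|` X| <= #|` sumset X B| * #|` sumset X C|)%N.
Proof.
move=> minX; have [n] := ubnP #|` C|; elim: n => // n IH in C * => leC.
have [->|[c cC]] := fset_0Vmem C; first by rewrite !sumset0 !cardfs0 muln0.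
pose D := C `\ c.
have EC : C = c |` D by rewrite fsetD1K.
have /IH {IH} IHD : (#|` D| < n)%N by move: leC; rewrite (cardfsD1 c) cC.
have sDC : D `<=` C by rewrite fsubsetDl.
pose Z := [fset x in X | x + c \in sumset X D].
have sZX : Z `<=` X by apply/fsubsetP => x; rewrite !inE /= => /andP[].
pose sh (E : {fset G}) := sumset E [fset c].
(* The new elements are exactly the [x + c] with [x] outside [Z], so this count is an equality; for
   X + B + C an upper bound suffices. *)
have cardXC : #|` sumset X C| = (#|` sumset X D| + (#|` X| - #|` Z|))%N.
  have -> : sumset X C = sumset X D `|` (sh X `\` sh Z).
    apply/fsetP => u; rewrite in_fsetU in_fsetD; apply/sumsetP/orP.
      move=> [x [e [xX eC ->]]].
      have [|nXD] := boolP (x + e \in sumset X D); [by left|right].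
      have ec : e = c.
        move: eC; rewrite EC in_fset1U => /orP[/eqP //|eD].
        by case/negP: nXD; apply: mem_sumset.
      rewrite ec in nXD *; rewrite [X in _ && X]mem_sumset ?in_fset1 // andbT.
      apply/sumsetP => -[z [c' [zZ]]]; rewrite in_fset1 => /eqP -> /addIr xz.
      by move: zZ; rewrite -xz !inE /= (negPf nXD) andbF.
    case=> [/sumsetP[x [e [xX eD ->]]]|/andP[_ /sumsetP[x [e [xX ec ->]]]]].
      by exists x, e; split=> //; apply: (fsubsetP sDC).
    by exists x, e; split=> //; rewrite (eqP (_ : e == c)) // -in_fset1.
  rewrite cardfsU.
  have -> : sumset X D `&` (sh X `\` sh Z) = fset0.
    apply/fsetP => u; rewrite in_fsetI in_fsetD in_fset0.
    apply/negP => /and3P[uXD nZ /sumsetP[x [c' [xX]]]].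
    rewrite in_fset1 => /eqP -> Eu; case/negP: nZ; rewrite Eu mem_sumset ?in_fset1 //.
    by rewrite !inE /= xX -Eu.
  rewrite cardfs0 subn0 cardfsD (fsetIidPr _) ?sumsetSS //.
  by rewrite !card_sumset1.
have cardXBC : (#|` sumset (sumset X B) C| <=
    #|` sumset (sumset X B) D| + (#|` sumset X B| - #|` sumset Z B|))%N.
  have sub : sumset (sumset X B) C `<=`
      sumset (sumset X B) D `|` (sh (sumset X B) `\` sh (sumset Z B)).
    apply/fsubsetP => u /sumsetP[w [e [wXB eC ->]]]; rewrite in_fsetU in_fsetD.
    have [//|nXBD] := boolP (w + e \in sumset (sumset X B) D).
    have ec : e = c.
      move: eC; rewrite EC in_fset1U => /orP[/eqP //|eD].
      by case/negP: nXBD; apply: mem_sumset.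
    rewrite ec in nXBD *; rewrite [X in _ && X]mem_sumset ?in_fset1 // andbT /=.
    apply/sumsetP => -[z [c' [/sumsetP[x [b [xZ bB ->]]]]]].
    rewrite in_fset1 => /eqP -> Ew; case/negP: nXBD; rewrite Ew.
    (* As [x + c = x' + e'] with [e'] in [D], the sum [x + b + c] equals [x' + b + e'], already in X
       + B + D. *)
    move: xZ; rewrite !inE /= => /andP[xX /sumsetP[x' [e' [x'X e'D Exc]]]].
    by rewrite addrAC Exc addrAC mem_sumset // mem_sumset.
  apply: leq_trans (fsubset_leq_card sub) _.
  rewrite cardfsU (leq_trans (leq_subr _ _)) // leq_add2l cardfsD.
  by rewrite (fsetIidPr _) ?card_sumset1 // !sumsetSS.
have := minX Z sZX; have := fsubset_leq_card sZX.
have := fsubset_leq_card (sumsetSS _ _ _ _ _ sZX (fsubset_refl B)).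
rewrite cardXC; move: IHD cardXBC.
by nia.
Qed.

Lemma doubling_of_tripling_bound (G : zmodType) (V A B : {fset G}) :
  A != fset0 -> B != fset0 -> V `<=` A -> V `<=` B ->
  (forall X Y, tripling_bound V X Y) ->
  (#|` V| * (#|` A| * #|` B|) <= #|` sumset A B| ^ 2)%N.
Proof.
move=> A0 B0 sVA sVB tb.
wlog leBA : A B A0 B0 sVA sVB / (#|` B| <= #|` A|)%N.
  move=> wl; case: (leqP #|` B| #|` A|) => [|/ltnW]; first exact: wl.
  by rewrite sumsetC [(#|` A| * _)%N]mulnC; apply: wl.
have [X /andP[X0 sXA] minX] := exists_min_expansion _ A B A0.
have := petridis _ X B V (fun Z sZX => minX Z (fsubset_trans sZX sXA)).
have := minX A (fsubset_refl A); have := tb X B; rewrite /tripling_bound.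
have := fsubset_leq_card sXA.
have := fsubset_leq_card (sumsetSS _ _ _ _ _ (fsubset_refl X) sVB).
move: X0; rewrite -cardfs_gt0.
move: leBA; set a := #|` A|; set b := #|` B|; set x := #|` X|.
set S := #|` sumset X B|; set T := #|` sumset A B|; set v := #|` V|.
set w := #|` sumset (sumset X B) V|; set y := #|` sumset X V|.
move=> leba x0 yS xa vw ST wx.
(* Petridis' bound, with |X + V| <= |X + B| because [V] lies in [B]. *)
have wxS : (w * x <= S ^ 2)%N by rewrite (leq_trans wx) // leq_mul2l yS orbT.
have h1 : (v ^ 2 * b * x ^ 3 <= S ^ 4)%N.
  have -> : (v ^ 2 * b * x ^ 3 = v ^ 2 * (x * b) * x ^ 2)%N by ring.
  rewrite (expnM S 2 2) (leq_trans (leq_mul vw (leqnn _))) //.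
  by rewrite -expnMn leq_exp2r.
(* Minimality of [X] tested against [A] itself, raised to the fourth power to match [h1]. *)
have h2 : (S ^ 4 * a ^ 4 <= T ^ 4 * x ^ 4)%N by rewrite -!expnMn leq_exp2r.
have h3 : (v ^ 2 * b * a ^ 4 <= T ^ 4 * a)%N.
  rewrite -(leq_pmul2r (_ : 0 < x ^ 3)%N) ?expn_gt0 ?x0 //.
  have -> : (v ^ 2 * b * a ^ 4 * x ^ 3 = v ^ 2 * b * x ^ 3 * a ^ 4)%N by ring.
  apply: leq_trans (leq_mul h1 (leqnn _)) _; apply: leq_trans h2 _.
  have -> : (T ^ 4 * a * x ^ 3 = T ^ 4 * (x ^ 3 * a))%N by ring.
  by rewrite leq_mul2l (expnSr x 3) leq_mul2l xa !orbT.
have a0 := leq_trans x0 xa.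
(* Square the goal and multiply it by [a]; then [b <= a] reduces it to [h3]. *)
rewrite -(@leq_exp2r _ _ 2) // -expnM.
rewrite -(leq_pmul2r a0); apply: leq_trans h3.
have -> : ((v * (a * b)) ^ 2 * a = v ^ 2 * b * (a ^ 3 * b))%N by ring.
by rewrite leq_mul2l (expnSr a 3) leq_mul2l leba !orbT.
Qed.

Theorem mainTheorem1 (R : realType) (G : zmodType) (d : nat) (U : {fset G}) :
  quasicube d U ->
  (forall V : {fset G}, V `<=` U ->
     beta R V = (#|` V|)%:R /\ Num.sqrt ((#|` V|)%:R) <= alpha R V) /\
  (beta R U = 2%:R ^+ d /\ Num.sqrt (2%:R ^+ d) <= alpha R U).
Proof.
move=> cubeU.
suff bounds (V : {fset G}) : V `<=` U ->
    beta R V = (#|` V|)%:R /\ Num.sqrt ((#|` V|)%:R) <= alpha R V.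
  split=> //; rewrite -natrX -(card_quasicube _ _ _ cubeU).
  exact: bounds (fsubset_refl U).
move=> sVU; have tb := quasicube_tripling_bound R _ _ _ _ cubeU sVU.
have sqrt_gt0 (A B : {fset G}) : A != fset0 -> B != fset0 ->
    0 < Num.sqrt (#|` A|%:R * #|` B|%:R) :> R.
  by move=> A0 B0; rewrite sqrtr_gt0 mulr_gt0 ?ltr0n ?cardfs_gt0.
have one_neq0 : [fset (0 : G)] != fset0 by apply/fset0Pn; exists 0; rewrite in_fset1.
set E := [set r : R | exists A B : {fset G}, [/\ A != fset0, B != fset0 &
            r = Defs.ratio R #|` sumset (sumset A B) V| #|` A| #|` B|]]%classic.
(* The infimum is attained at A = B = {0}. *)
have E_V : E #|` V|%:R.
  exists [fset 0], [fset 0]; split=> //; rewrite /Defs.ratio sumsetC.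
  have -> : sumset [fset (0 : G)] [fset 0] = [fset 0 + 0].
    by apply/eqP; rewrite eq_sym eqEfcard fsub1set mem_sumset ?in_fset1 //
      card_sumset1 !cardfs1.
  by rewrite card_sumset1 !cardfs1 mul1r sqrtr1 divr1.
have lbE : lbound E #|` V|%:R.
  move=> _ [A [B [A0 B0 ->]]]; rewrite /Defs.ratio ler_pdivlMr ?sqrt_gt0 //.
  by rewrite sqrtrM ?ler0n //; apply/tripling_boundP.
split.
  rewrite /beta -/E; apply/eqP; rewrite eq_le lb_le_inf ?andbT //; last by exists #|` V|%:R.
  by apply: ge_inf => //; exists #|` V|%:R.
apply: lb_le_inf.
  (* The bound on [inf] requires a nonempty set of ratios; adjoining 0 gives an admissible pair even
     when [V] is empty. *)
  have V0 : 0 |` V != fset0 by apply/fset0Pn; exists 0; rewrite in_fset1U eqxx.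
  eexists; exists (0 |` V), (0 |` V); split; [exact: V0|exact: V0| | |reflexivity];
  exact: fsubsetU1.
move=> _ [A [B [A0 B0 sVA sVB ->]]]; rewrite /Defs.ratio ler_pdivlMr ?sqrt_gt0 //.
rewrite -sqrtrM ?ler0n // -(ger0_norm (ler0n R #|` sumset A B|)) -sqrtr_sqr.
rewrite ler_wsqrtr // -!natrM -natrX ler_nat.
exact: doubling_of_tripling_bound.
Qed.
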